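(* Let $G$ be a graph with at least one isolated vertex, let $T$ be a (possibly empty) minimum twin cover of $G$, and let $t\ge1$. (i) If $G=K_1$, then $\det(G)=0$ and $\det(\mu_t(G))=t$. (ii) If $G\ne K_1$, then $\det(\mu_t(G))=t|T|+\det(G)+t-1$.
   Context: All graphs are finite and simple. For a graph $G$ with $V(G)=\{v_1,\dots,v_n\}$ and an integer $t\ge1$, the generalized Mycielskian $\mu_t(G)$ has vertex set $\{u_i^s: 1\le i\le n,\ 0\le s\le t\}\cup\{w\}$, where $u_i^0$ is identified with $v_i$. Its edges are: $u_i^0u_j^0$ for each edge $v_iv_j$ of $G$; $u_i^su_j^{s+1}$ and $u_j^su_i^{s+1}$ for each edge $v_iv_j$ of $G$ and each $0\le s<t$; and $u_i^tw$ for all $1\le i\le n$. A set $S\subseteq V(G)$ is a determining set for $G$ if the only automorphism of $G$ fixing every vertex of $S$ is the identity; $\det(G)$ is the minimum size of a determining set. Two vertices are twins if they have the same open neighborhood. A minimum twin cover of a graph is a subset of its vertices of minimum size that contains at least one vertex from every pair of distinct twin vertices; it is empty if the graph has no twins. *)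

(* Defs.v *)
From mathcomp Require Import all_boot all_fingroup.
Set Implicit Arguments. Unset Strict Implicit. Unset Printing Implicit Defensive.

Section Graphs.
Variable V : finType.

Definition simple_graph (e : rel V) : Prop := symmetric e /\ irreflexive e.

Definition is_aut (e : rel V) (f : {perm V}) : bool :=
  [forall x, forall y, e (f x) (f y) == e x y].

Definition determining (e : rel V) (S : {set V}) : bool :=
  [forall f : {perm V}, is_aut e f ==> [forall x in S, f x == x] ==> (f == 1%g)].

(* det(G): minimum size of a determining set (V itself is always one, so
   #|V| is a safe initial value for the min). *)
Definition det_num (e : rel V) : nat :=
  \big[minn/#|V|]_(S : {set V} | determining e S) #|S|.

Definition isolated (e : rel V) (v : V) : bool := [forall u, ~~ e v u].

Definition nbhd (e : rel V) (x : V) : {set V} := [set y | e x y].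
Definition twins (e : rel V) (x y : V) : bool := (x != y) && (nbhd e x == nbhd e y).

Definition twin_cover (e : rel V) (T : {set V}) : Prop :=
  forall x y, twins e x y -> (x \in T) || (y \in T).

Definition min_twin_cover (e : rel V) (T : {set V}) : Prop :=
  twin_cover e T /\ forall T' : {set V}, twin_cover e T' -> #|T| <= #|T'|.

End Graphs.

(* generalized Mycielskian mu_t(G): vertex Some (s, v) is u_v^s (s in 0..t),
   None is the apex w. *)
Definition myc_vertex (t : nat) (V : finType) : finType := option ('I_t.+1 * V).

Definition myc_rel (t : nat) (V : finType) (e : rel V) : rel (myc_vertex t V) :=
  fun a b =>
    match a, b with
    | Some (s, i), Some (s', j) =>
        (((s == 0 :> nat) && (s' == 0 :> nat)) ||
         ((s.+1 == s' :> nat) || (s'.+1 == s :> nat))) && e i j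
    | Some (s, _), None => s == t :> nat
    | None, Some (s, _) => s == t :> nat
    | None, None => false
    end.
Arguments myc_rel t {V} e _ _.

(* Main.v *)
Require Import Defs.
From mathcomp Require Import all_boot all_fingroup zify.
Set Implicit Arguments. Unset Strict Implicit. Unset Printing Implicit Defensive.

(** In mu_t(G) the isolated vertices are the copies, at the levels below t, of
    those of G: t times as many, forming one twin class, which accounts for the
    extra t - 1.  When |V(G)| >= 2, the apex w is the only vertex with a pendant
    neighbour, so every automorphism fixes w, hence preserves the level of each
    non-isolated vertex (it is read off the distance to w).  It acts on level 0
    as an automorphism of G, and on each later level as the same one up to
    twins.  So a determining set of G at level 0 with a twin cover at each other
    level suffices, once completed on the isolated vertices.  Conversely an
    automorphism of G fixing a twin cover fixes every twinned vertex; lifting it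
    levelwise shows that T, with the untwinned vertices occurring at any
    level of a determining set of mu_t(G), determines G. *)


(** * Determining sets, automorphisms and twins in an arbitrary graph *)

Section Determining.
Variables (V : finType) (e : rel V).

Lemma is_autP (f : {perm V}) :
  reflect (forall x y, e (f x) (f y) = e x y) (is_aut e f).
Proof.
apply: (iffP forallP) => [H x y|H x]; first by have /forallP/(_ y)/eqP := H x.
by apply/forallP => y; apply/eqP.
Qed.

Lemma determiningP (S : {set V}) :
  reflect (forall f : {perm V}, is_aut e f -> {in S, forall x, f x = x} -> f = 1%g)
          (determining e S).
Proof.
apply: (iffP forallP) => [H f fA fS|H f].
  have /implyP/(_ fA)/implyP H1 := H f; apply/eqP/H1.
  by apply/forallP => x; apply/implyP => /fS ->.
apply/implyP => fA; apply/implyP => /forallP fS; apply/eqP/H => // x xS.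
by have /implyP/(_ xS)/eqP := fS x.
Qed.

Lemma is_autV (f : {perm V}) : is_aut e f -> is_aut e f^-1%g.
Proof.
by move=> /is_autP fA; apply/is_autP => x y; rewrite -{2}(permKV f x) -{2}(permKV f y) fA.
Qed.

Lemma aut_isolated (f : {perm V}) x : is_aut e f -> isolated e x -> isolated e (f x).
Proof.
move=> /is_autP fA /forallP x0; apply/forallP => u.
by rewrite -(permKV f u) fA.
Qed.

Lemma det_num_le (S : {set V}) : determining e S -> det_num e <= #|S|.
Proof.
rewrite /det_num; have := mem_index_enum S.
elim: (index_enum _) => // A r IHr; rewrite inE big_cons => /orP[/eqP<- ->|Sr dS].
  exact: geq_minl.
by case: ifP => _; rewrite ?(leq_trans (geq_minr _ _)) ?IHr.
Qed.

Lemma det_num_attained : exists2 S, determining e S & #|S| = det_num e.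
Proof.
rewrite /det_num; elim/big_ind: _ => [|m n Hm Hn|S dS].
- exists setT; last exact: cardsT.
  by apply/determiningP => f _ fS; apply/permP => x; rewrite perm1 fS.
- by rewrite /minn; case: ifP.
- by exists S.
Qed.

Lemma det_num_ge n : (forall S, determining e S -> n <= #|S|) -> n <= det_num e.
Proof. by move=> H; have [S /H ? <-] := det_num_attained. Qed.

Lemma twinsP x y : reflect (x <> y /\ e x =1 e y) (twins e x y).
Proof.
apply: (iffP andP) => [[/eqP neq /eqP eqN]|[/eqP neq eqN]]; split=> //.
  by move=> z; move/setP/(_ z): eqN; rewrite !inE.
by apply/eqP/setP => z; rewrite !inE.
Qed.

Lemma isolated_twins x y : isolated e x -> isolated e y -> x != y -> twins e x y.
Proof.
move=> /forallP x0 /forallP y0 /eqP neq; apply/twinsP; split=> // z.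
by rewrite (negbTE (x0 z)) (negbTE (y0 z)).
Qed.

Lemma tperm_twins_aut x y : symmetric e -> twins e x y -> is_aut e (tperm x y).
Proof.
move=> sym_e /twinsP[_ eqN]; have tpl a c : e (tperm x y a) c = e a c.
  by case: tpermP => [->|->|].
by apply/is_autP => a b; rewrite tpl sym_e tpl sym_e.
Qed.

(** If [S] missed both points, the transposition would be a nontrivial automorphism fixing [S]
    pointwise. *)
Lemma determining_tperm (S : {set V}) x y :
  determining e S -> x <> y -> is_aut e (tperm x y) -> (x \in S) || (y \in S).
Proof.
move=> /determiningP dS neq tA; apply/norP => -[xS yS].
case: neq; move: (tpermR x y); rewrite (dS _ tA) ?perm1 // => z zS.
by rewrite tpermD //; [move: xS | move: yS]; apply: contraNneq => ->.
Qed.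

Lemma determining_twin_cover (S : {set V}) :
  symmetric e -> determining e S -> twin_cover e S.
Proof.
move=> sym_e dS x y tw; apply: (determining_tperm dS); last exact: tperm_twins_aut.
by case/twinsP: tw.
Qed.

Definition twinned : {set V} := [set x | [exists y, twins e x y]].

Lemma twinned_l x y : twins e x y -> x \in twinned.
Proof. by move=> tw; rewrite inE; apply/existsP; exists y. Qed.

Lemma twins_sym x y : twins e x y = twins e y x.
Proof. by rewrite /twins eq_sym [nbhd e x == _]eq_sym. Qed.

(** Lets minimality of [T] bound the twinned part of a cover alone, so that its untwinned vertices
    can be counted separately. *)
Lemma twin_coverI_twinned (T : {set V}) : twin_cover e T -> twin_cover e (T :&: twinned).
Proof.
move=> cT x y tw; have := cT x y tw; rewrite !in_setI (twinned_l tw).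
by move: (tw); rewrite twins_sym => /twinned_l ->; rewrite !andbT.
Qed.

(** A twinned [x] outside [T] has its twin [y] in [T]. As [f] fixes [y], a moved [x] would be a twin
    of [f x]; the cover then contains [f x], which is fixed, and injectivity gives [f x = x]. *)
Lemma aut_fixes_twinned (T : {set V}) (f : {perm V}) : symmetric e ->
  twin_cover e T -> is_aut e f -> {in T, forall x, f x = x} ->
  {in twinned, forall x, f x = x}.
Proof.
move=> sym_e cT /is_autP fA fT x; rewrite inE => /existsP[y tw].
have [/fT//|xT] := boolP (x \in T).
have yT : y \in T by have := cT x y tw; rewrite (negbTE xT).
have [//|neq] := eqVneq (f x) x.
have twfx : twins e x (f x).
  case/twinsP: tw => _ eqN; apply/twinsP; split; first by move=> H; rewrite -H eqxx in neq.
  move=> z; rewrite eqN -{1}(permKV f z) -{1}(fT y yT) fA -eqN.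
  by rewrite -fA permKV.
have := cT _ _ twfx; rewrite (negbTE xT) /= => /fT /perm_inj fxx.
by rewrite fxx eqxx in neq.
Qed.

End Determining.

(** * Edges, isolated vertices, twins, lifted automorphisms and levels of the Mycielskian *)

Section Mycielskian.
Variables (V : finType) (e : rel V) (t : nat).
Hypotheses (sym_e : symmetric e) (t_gt0 : 0 < t).
Local Notation mu := (myc_rel t e).
Local Notation lev s i := (Some (s, i) : myc_vertex t V).
Implicit Types (s : 'I_t.+1) (i j v : V).

Lemma myc_sym : symmetric mu.
Proof.
move=> [[s i]|] [[s' j]|] //=; rewrite sym_e; congr (_ && _).
by rewrite andbC [(_ == _ :> nat) || (_ == _)]orbC.
Qed.

Lemma not_isolated i : ~~ isolated e i -> exists j, e i j.
Proof. by rewrite negb_forall => /existsP[j]; rewrite negbK => eij; exists j. Qed.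

Lemma isolatedF i j : isolated e i -> e i j = false.
Proof. by move=> /forallP/(_ j)/negbTE. Qed.

Lemma inord_succ s : s < t -> (inord s.+1 : 'I_t.+1) = s.+1 :> nat.
Proof. by move=> st; rewrite inordK. Qed.

Lemma myc_edge_up s s' i j : s.+1 = s' -> mu (lev s i) (lev s' j) = e i j.
Proof. by move=> E; rewrite /= E eqxx orbT. Qed.

Lemma myc_isolated s i : s < t -> isolated e i -> isolated mu (lev s i).
Proof.
move=> st i0; apply/forallP => -[[s' j]|] /=; last by rewrite ltn_eqF.
by rewrite (isolatedF _ i0) andbF.
Qed.

(** The vertex [v] gives the apex a neighbour; a top vertex sees the apex, and a lower one sees
    copies of its neighbours one level up. *)
Lemma myc_isolated_inv v x : isolated mu x ->
  exists s i, [/\ x = lev s i, s < t & isolated e i].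
Proof.
case: x => [[s i]|] /forallP x0; last first.
  by have := x0 (lev ord_max v); rewrite /= eqxx.
exists s, i; have st : s < t.
  by have /= := x0 None; have := ltn_ord s; lia.
split=> //; apply/forallP => j.
by have := x0 (lev (inord s.+1) j); rewrite myc_edge_up // inord_succ.
Qed.

Lemma myc_twins s i j : twins e i j -> twins mu (lev s i) (lev s j).
Proof.
move=> /twinsP[neq eqN]; apply/twinsP; split=> [[]//|].
by move=> [[s' k]|] //=; rewrite eqN.
Qed.

Lemma lift_fun_inj (g : {perm V}) :
  injective (fun x : myc_vertex t V => if x is Some (s, i) then lev s (g i) else None).
Proof.
by move=> [[s i]|] [[s' j]|] //= [-> /perm_inj ->].
Qed.

Definition lift_aut (g : {perm V}) : {perm myc_vertex t V} := perm (@lift_fun_inj g).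

Lemma lift_autP (g : {perm V}) : is_aut e g -> is_aut mu (lift_aut g).
Proof.
move=> /is_autP gA; apply/is_autP => -[[s i]|] [[s' j]|]; rewrite !permE //=.
by rewrite gA.
Qed.

Definition level (S : {set myc_vertex t V}) s : {set V} := [set i | lev s i \in S].

Definition of_levels (A : 'I_t.+1 -> {set V}) : {set myc_vertex t V} :=
  Some @: [set p : 'I_t.+1 * V | p.2 \in A p.1].

Lemma sum_card_levels (A : 'I_t.+1 -> {set V}) :
  \sum_s #|A s| = #|[set p : 'I_t.+1 * V | p.2 \in A p.1]|.
Proof.
rewrite -sum1_card (eq_bigl (fun p => xpredT p.1 && (p.2 \in A p.1))); last by move=> p; rewrite inE.
rewrite -(pair_big_dep xpredT (fun s i => i \in A s) (fun _ _ => 1)) /=.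
by apply: eq_bigr => s _; rewrite sum1_card.
Qed.

Lemma card_of_levels A : #|of_levels A| = \sum_s #|A s|.
Proof. by rewrite card_imset ?sum_card_levels //; apply: Some_inj. Qed.

Lemma mem_of_levels A s i : (lev s i \in of_levels A) = (i \in A s).
Proof. by rewrite mem_imset ?inE //; apply: Some_inj. Qed.

Lemma sum_card_level S : \sum_s #|level S s| <= #|S|.
Proof.
rewrite -card_of_levels subset_leq_card //; apply/subsetP => _ /imsetP[[s i] H ->].
by move: H; rewrite !inE.
Qed.

(** * The lower bound: what a determining set of [mu] contains on each level *)

Lemma level_twin_cover S s : determining mu S -> twin_cover e (level S s).
Proof.
move=> dS i j tw; rewrite !inE.
exact: (determining_twin_cover myc_sym dS) (myc_twins s tw).
Qed.

Lemma determining_isolated S (a b : myc_vertex t V) : determining mu S ->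
  isolated mu a -> isolated mu b -> a \notin S -> b \notin S -> a = b.
Proof.
move=> dS a0 b0 aS bS; apply/eqP; apply: contraNT aS => neq.
by have := determining_twin_cover myc_sym dS (isolated_twins a0 b0 neq); rewrite (negbTE bS) orbF.
Qed.

(* All isolated vertices below level t are twins, so at most one of them, at
   (s0, v0), escapes S. *)
Lemma determining_missing S v : isolated e v -> determining mu S ->
  exists s0 v0, [/\ isolated e v0, s0 < t &
    forall s i, s < t -> isolated e i -> (s, i) != (s0, v0) -> i \in level S s].
Proof.
move=> v0 dS.
have [/existsP[[s0 v1] /and3P[/= lt0 iso1 nS]]|/existsPn H] :=
  boolP [exists p : 'I_t.+1 * V, [&& p.1 < t, isolated e p.2 & lev p.1 p.2 \notin S]].
  exists s0, v1; split=> // s i st i0; rewrite inE; apply: contraNT => iS.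
  have [-> ->] // : Some (s, i) = Some (s0, v1).
  by apply: (determining_isolated dS); rewrite ?myc_isolated.
exists ord0, v; split=> // s i st i0 _; rewrite inE.
by have := H (s, i); rewrite /= st i0 negbK.
Qed.

(** The source of the extra [t - 1]: among the [t] levels below the top, one is exempt, namely the
    level allowed to miss an isolated vertex. *)
Lemma sum_below_neq s0 : s0 < t -> \sum_(s < t.+1) ((s < t) && (s != s0)) = t.-1.
Proof.
move=> lt0; rewrite (eq_bigr (fun s => if s \in ~: [set s0; ord_max] then 1 else 0)).
  rewrite -big_mkcond sum1_card cardsCs setCK cards2 card_ord.
  by rewrite -val_eqE /= ltn_eqF ?subn2.
move=> s _; rewrite !inE negb_or -(val_eqE s ord_max) /= andbC.
by have -> : (s < t) = (val s != t) by have /= := ltn_ord s; lia.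
Qed.

Lemma det_num_myc_ge (T : {set V}) v : isolated e v -> min_twin_cover e T ->
  t * #|T| + det_num e + t.-1 <= det_num mu.
Proof.
move=> v_iso [cT minT]; apply: det_num_ge => S dS.
have [s0 [v0 [iso0 lt0 memS]]] := determining_missing v_iso dS.
(* On a spare level every isolated vertex is in [S]. Since [v0] has only isolated twins, deleting it
   there still leaves a twin cover and saves one vertex. *)
pose spare s := (s < t) && (s != s0).
pose B s := if spare s then level S s :\ v0 else level S s.
have spareS s : spare s -> v0 \in level S s.
  by case/andP=> st neq; apply: memS => //; rewrite xpair_eqE negb_and neq.
have cB s : twin_cover e (B s).
  rewrite /B; case: ifP => [/andP[st neq]|_]; last exact: level_twin_cover.
  move=> i j tw; have := level_twin_cover s dS tw; rewrite !in_setD1.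
  have isoS k : isolated e k -> k \in level S s.
    by move=> k0; apply: memS => //; rewrite xpair_eqE negb_and neq.
  have [Ei|_] := eqVneq i v0.
    have j0 : isolated e j.
      by apply/forallP => u; case/twinsP: tw => _ <-; rewrite Ei isolatedF.
    by rewrite (isoS _ j0); case/andP: tw; rewrite Ei eq_sym => -> _; rewrite orbT.
  have [Ej|_] //= := eqVneq j v0.
  have i0 : isolated e i.
    by apply/forallP => u; case/twinsP: tw => _ ->; rewrite Ej isolatedF.
  by rewrite (isoS _ i0).
have cardB s : #|level S s| = #|B s| + spare s.
  rewrite /B; case: ifP => [/spareS v0S|]; last by rewrite addn0.
  by rewrite (cardsD1 v0 (level S s)) v0S addnC.
(* [D] keeps one twin cover of G and gathers the untwinned vertices of all levels. *)
pose D := T :|: \bigcup_s (B s :\: twinned e).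
have dD : determining e D.
  apply/determiningP => f fA fD.
  have fT : {in twinned e, forall i, f i = i}.
    by apply: (aut_fixes_twinned sym_e cT fA) => i iT; rewrite fD // inE iT.
  (* A moved isolated vertex would be a twin of its image, hence already fixed by [fT]. *)
  have fiso i : isolated e i -> f i = i.
    move=> i0; have [//|neq] := eqVneq (f i) i.
    have := isolated_twins i0 (aut_isolated fA i0); rewrite eq_sym neq.
    by move=> /(_ isT) /twinned_l /fT.
  suff lift1 : lift_aut f = 1%g.
    apply/permP => i; have /permP/(_ (lev ord0 i)) := lift1.
    by rewrite !permE => -[].
  have /determiningP := dS; apply; first exact: lift_autP.
  move=> [[s i]|] xS; rewrite permE //; congr (Some (s, _)).
  have [/fT//|itw] := boolP (i \in twinned e).
  have [/fiso//|i_niso] := boolP (isolated e i).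
  (* Here [i] is neither twinned nor isolated, so it differs from the deleted [v0] and survives in
     [B s]. *)
  apply: fD; rewrite inE; apply/orP; right; apply/bigcupP; exists s => //.
  have iS : i \in level S s by rewrite inE.
  rewrite inE itw /B; case: ifP => _ //; rewrite in_setD1 iS andbT.
  by apply: contraNneq i_niso => ->.
apply: leq_trans (sum_card_level S).
rewrite (eq_bigr _ (fun s _ => cardB s)) big_split /= sum_below_neq // leq_add2r.
have leD : #|D| <= #|T| + \sum_s #|B s :\: twinned e|.
  apply: leq_trans (leq_card_setU _ _) _; rewrite leq_add2l.
  by elim/big_rec2: _ => [|s n A _ IH]; rewrite ?cards0 // (leq_trans (leq_card_setU _ _)) // leq_add2l.
have geB s : #|T| + #|B s :\: twinned e| <= #|B s|.
  by rewrite -(cardsID (twinned e) (B s)) leq_add2r minT //; apply: twin_coverI_twinned.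
(* Summing over [t + 1] levels gives [t + 1] copies of [#|T|]; one of them joins the untwinned parts
   to bound [#|D|]. *)
have := leq_sum (index_enum 'I_t.+1) (P := xpredT) (fun s _ => geB s).
rewrite big_split /= sum_nat_const card_ord mulSn addnAC => sum_ge.
rewrite addnC (leq_trans _ sum_ge) // leq_add2r; exact: leq_trans (det_num_le dD) leD.
Qed.

(** * Automorphisms fix the apex and respect levels; the upper bound for graphs with more than one
    vertex *)

Section FixApex.
Hypothesis V_neq1 : #|V| <> 1.
Variable v : V.
Hypothesis v_iso : isolated e v.

(* A pendant neighbour of the apex can only go to a pendant vertex, whose
   neighbour is the apex again. *)
Lemma aut_fixes_apex (f : {perm myc_vertex t V}) : is_aut mu f -> f None = None.
Proof.
move=> /is_autP fA; pose x := lev ord_max v.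
have nbx y : mu x y -> y = None.
  by case: y => [[s j]|] //=; rewrite (isolatedF _ v_iso) andbF.
have nbfx y : mu (f x) y -> y = f None.
  by rewrite -(permKV f y) fA => /nbx ->.
have : mu (f x) (f None) by rewrite fA /= eqxx.
case Efx: (f x) nbfx => [[s i]|] nbfx.
- have [Es|st] := eqVneq (val s) t; first by move=> _; rewrite -(nbfx None) //= Es.
  case Ew: (f None) nbfx => [[s' j]|//] nbfx /andP[_ eij].
  have lt_st : s < t by have /= := ltn_ord s; move: st => /= ; lia.
  have := nbfx (lev (inord s.+1) j); rewrite myc_edge_up ?inord_succ // => /(_ eij) E1.
  (* A second neighbour, one level down; for [s = 0] the truncated predecessor is 0 again, and level
     0 carries the edges of G. *)
  have := nbfx (lev (inord s.-1) j); rewrite -E1 /= inordK; last lia.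
  rewrite eij andbT => E2; have /E2 : (s == 0 :> nat) && (s.-1 == 0)
    || ((s.+1 == s.-1) || (s.-1.+1 == s)) by lia.
  by case=> /(congr1 val) /=; rewrite !inordK; lia.
(* If [f x] is the apex, the apex has a single neighbour, so the top level has one vertex. *)
- move=> _; case: V_neq1; apply/eqP; rewrite -cardsT; apply/cards1P; exists v.
  have nb1 i : lev ord_max i = f None by apply: nbfx; rewrite /= eqxx.
  apply/setP => i; rewrite !inE; apply/esym/eqP.
  by have := nb1 i; rewrite -(nb1 v) => -[].
Qed.

Lemma aut_top (f : {perm myc_vertex t V}) i : is_aut mu f ->
  exists j, f (lev ord_max i) = lev ord_max j.
Proof.
move=> fA; have /is_autP fE := fA; have := fE None (lev ord_max i).
rewrite (aut_fixes_apex fA) /= eqxx.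
case: (f _) => [[s j]|] //= /eqP E; exists j; congr (Some (_, _)); exact: val_inj.
Qed.

(* The level of a non-isolated vertex is t + 1 minus its distance to the apex;
   an automorphism fixing the apex cannot decrease it. *)
Lemma aut_level_ge (f : {perm myc_vertex t V}) s i : is_aut mu f -> ~~ isolated e i ->
  exists s' i', f (lev s i) = lev s' i' /\ s <= s'.
Proof.
move=> fA; have /is_autP fE := fA; have [k] := ubnP (t - s); elim: k => // k IHk in s i *.
move=> ltk i_niso; have [Es|st] := eqVneq (val s) t.
  have -> : s = ord_max by apply: val_inj.
  by have [j ->] := aut_top i fA; exists ord_max, j.
have lt_st : s < t by have /= := ltn_ord s; move: st => /= ; lia.
have [j eij] := not_isolated i_niso.
have j_niso : ~~ isolated e j by apply: contraTN eij => j0; rewrite sym_e isolatedF.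
have [|s1 [j1 [E1 le1]]] := IHk (inord s.+1) j _ j_niso; first by rewrite inord_succ //; lia.
rewrite inord_succ // in le1.
have := fE (lev s i) (lev (inord s.+1) j); rewrite myc_edge_up ?inord_succ // eij E1.
case E: (f (lev s i)) => [[s' i']|] /=.
  by case/andP=> H _; exists s', i'; split=> //; lia.
by move=> _; have := aut_fixes_apex fA; rewrite -[RHS]E => /perm_inj.
Qed.

(** The reverse inequality comes from [f^-1] at the image. If [i'] is isolated in G, either the
    image is on the top level, which [f^-1] preserves, or it is isolated in [mu], which would make
    [i] isolated. *)
Lemma aut_level (f : {perm myc_vertex t V}) s i : is_aut mu f -> ~~ isolated e i ->
  exists i', f (lev s i) = lev s i'.
Proof.
move=> fA i_niso; have [s' [i' [E le]]] := aut_level_ge s fA i_niso.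
suff le' : s' <= s.
  by exists i'; rewrite E; congr (Some (_, _)); apply/val_inj/eqP; rewrite eqn_leq le le'.
have fVA := is_autV fA; have EV : f^-1%g (lev s' i') = lev s i by rewrite -E permK.
have [i'0|i'_niso] := boolP (isolated e i'); last first.
  by have [s1 [i1 []]] := aut_level_ge s' fVA i'_niso; rewrite EV => -[<- _].
have [Es'|st'] := eqVneq (val s') t.
  have Em : s' = ord_max by apply: val_inj.
  by have [j] := aut_top i' fVA; rewrite -Em EV => -[->].
have lt' : s' < t by have /= := ltn_ord s'; move: st' => /= ; lia.
have [u] := not_isolated i_niso.
have := aut_isolated fVA (myc_isolated lt' i'0); rewrite EV.
case/(myc_isolated_inv v) => s1 [i1 [[_ ->] _ i1_iso]].
by rewrite isolatedF.
Qed.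

(** First [f] fixes all isolated vertices of [mu]; next, its restriction to level 0 is an
    automorphism of G, trivial by [A ord0]; then triviality climbs level by level, the twin covers
    removing the remaining freedom. *)
Lemma of_levels_determining (A : 'I_t.+1 -> {set V}) :
  determining e (A ord0) ->
  (forall s, 0 < s -> twin_cover e (A s)) ->
  (forall s i, 0 < s < t -> isolated e i -> i \in A s) ->
  determining mu (of_levels A).
Proof.
move=> dA0 cA isoA; apply/determiningP => f fA fS.
have /is_autP fE := fA; have fN := aut_fixes_apex fA.
have cA' s : twin_cover e (A s).
  have [|/cA//] := posnP s; move=> s_0; have -> : s = ord0 by apply: val_inj.
  exact: determining_twin_cover.
have fiso s i : s < t -> isolated e i -> f (lev s i) = lev s i.
  move=> st i0; have x0 := myc_isolated st i0; have fx0 := aut_isolated fA x0.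
  have [//|neq] := eqVneq (f (lev s i)) (lev s i).
  (* A moved vertex and its image both avoid the set. Being isolated, both must lie on level 0,
     where they would be twins missed by the cover [A ord0]. *)
  have xS : lev s i \notin of_levels A.
    by apply: contraNN neq => /fS ->.
  have fxS : f (lev s i) \notin of_levels A.
    by apply: contraNN neq => /fS /perm_inj ->.
  move: neq fxS fx0 xS; case: (f _) => [[s' i']|] neq; last first.
    by move=> _ /(myc_isolated_inv v) [? [? []]].
  rewrite !mem_of_levels => i'A /(myc_isolated_inv v) [_ [_ [[<- <-] st' i'0]]] iA.
  have s_0 : s = ord0.
    by apply: val_inj; apply/eqP; rewrite /= -leqn0 leqNgt; apply: contra iA => sp; rewrite isoA ?sp.
  have s'_0 : s' = ord0.
    by apply: val_inj; apply/eqP; rewrite /= -leqn0 leqNgt; apply: contra i'A => sp; rewrite isoA ?sp.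
  rewrite s_0 s'_0 in neq iA i'A *.
  have [-> //|neqi] := eqVneq i' i.
  by have := cA' ord0 _ _ (isolated_twins i'0 i0 neqi); rewrite (negbTE iA) (negbTE i'A).
have flev s i : exists j, f (lev s i) = lev s j.
  have [i0|] := boolP (isolated e i); last exact: aut_level.
  have [Es|st] := eqVneq (val s) t.
    by have -> : s = ord_max; [apply: val_inj | apply: aut_top].
  by exists i; apply: fiso => //; have /= := ltn_ord s; move: st => /= ; lia.
pose g0 i := if f (lev ord0 i) is Some (_, j) then j else i.
have fg0 i : f (lev ord0 i) = lev ord0 (g0 i).
  by rewrite /g0; have [j ->] := flev ord0 i.
have g0_inj : injective g0.
  by move=> i j E; have := fg0 i; rewrite E -fg0 => /perm_inj [].
have g1 : perm g0_inj = 1%g.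
  have /determiningP := dA0; apply.
    by apply/is_autP => i j; rewrite !permE; have := fE (lev ord0 i) (lev ord0 j); rewrite !fg0 /=.
  move=> i iA; rewrite permE; have := fg0 i; rewrite fS ?mem_of_levels //.
  by case.
have f0 i : f (lev ord0 i) = lev ord0 i by rewrite fg0 -(permE g0_inj) g1 perm1.
have fk k : forall s i, val s = k -> f (lev s i) = lev s i.
  elim: k => [|k IHk] s i Es; first by have -> : s = ord0 by apply: val_inj.
  have [//|neq] := eqVneq (f (lev s i)) (lev s i).
  have [j Ej] := flev s i.
  have neqij : i <> j by move=> E; rewrite Ej E eqxx in neq.
  have kt : k < t.+1 by have := ltn_ord s; rewrite -[nat_of_ord s]/(val s) Es; lia.
  pose s1 : 'I_t.+1 := Ordinal kt.
  (* The level below is fixed pointwise, so [i] and its image [j] have the same neighbours there. *)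
  have tw : twins e i j.
    apply/twinsP; split=> // u; rewrite sym_e [e j u]sym_e.
    rewrite -(myc_edge_up (s := s1) (s' := s)) // -(myc_edge_up (s := s1) (s' := s) u j) //.
    by rewrite -fE Ej IHk.
  have iA : i \notin A s.
    by apply: contraNN neq => iA; rewrite fS // mem_of_levels.
  have := cA' s _ _ tw; rewrite (negbTE iA) /= => jA.
  have : f (lev s j) = lev s j by rewrite fS // mem_of_levels.
  by rewrite -Ej => /perm_inj; rewrite Ej => -[] /esym.
apply/permP => -[[s i]|]; rewrite perm1 //; exact: fk.
Qed.

Lemma det_num_myc_le (T : {set V}) : twin_cover e T ->
  det_num mu <= t * #|T| + det_num e + t.-1.
Proof.
move=> cT.
(* A twin cover misses at most one isolated vertex; [v1] is that one, or [v] if none is missed. *)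
have [v1 isoT] : exists v1, forall i, isolated e i -> i \in v1 |: T.
  have [/existsP[v1 /andP[v1_iso v1T]]|/existsPn H] :=
    boolP [exists i, isolated e i && (i \notin T)].
    exists v1 => i i0; rewrite in_setU1; have [//|neq] := eqVneq i v1.
    by have := cT _ _ (isolated_twins i0 v1_iso neq); rewrite (negbTE v1T) orbF.
  exists v => i i0; rewrite in_setU1; have := H i; rewrite i0 /= negbK => ->.
  by rewrite orbT.
have [D dD <-] := det_num_attained e.
(* A minimum determining set at level 0, the cover [T] completed by [v1] on the [t - 1] intermediate
   levels, and [T] at the top. *)
pose A s : {set V} := if s == ord0 then D else if s < t then v1 |: T else T.
have Apos s : 0 < s -> A s = if s < t then v1 |: T else T.
  by rewrite /A -val_eqE /=; case: (val s).
have dA : determining mu (of_levels A).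
  apply: of_levels_determining; rewrite ?/A //.
  - move=> s /Apos; rewrite /A => ->; case: ifP => // _ i j /cT.
    by rewrite !in_setU1 => /orP[] ->; rewrite !orbT.
  - by move=> s i /andP[/Apos sp st] /isoT; rewrite -/(A s) sp st.
apply: leq_trans (det_num_le dA) _; rewrite card_of_levels.
rewrite (bigD1 ord0) //= {1}/A eqxx.
have leA s : s != ord0 -> #|A s| <= #|T| + ((s < t) && (s != ord0)).
  move=> s0; rewrite s0 andbT Apos ?lt0n //; case: ifP => _; last by rewrite addn0.
  by rewrite cardsU1 addnC leq_add2l; case: (_ \notin _).
apply: leq_trans (_ : #|D| + (t * #|T| + t.-1) <= _); last by lia.
rewrite leq_add2l; apply: leq_trans (leq_sum _ leA) _.
rewrite big_split /= sum_nat_const cardC1 card_ord /= leq_add2l.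
rewrite -(sum_below_neq (s0 := ord0)) //.
by rewrite [leqRHS](bigD1 ord0) //= leq_addl.
Qed.

End FixApex.

End Mycielskian.

(** * The one-vertex graph *)

Lemma det_num_card1 (V : finType) (e : rel V) : #|V| = 1 -> det_num e = 0.
Proof.
move=> V1; apply/eqP; rewrite -leqn0 -[leqRHS](cards0 V); apply: det_num_le.
apply/determiningP => f _ _; apply/permP => x; rewrite perm1.
by have /card_le1_eqP := eq_leq V1; apply.
Qed.

(* mu_t(K_1) is K_2 together with t isolated vertices. *)
Lemma det_num_myc_card1 (V : finType) (e : rel V) t : symmetric e -> irreflexive e ->
  0 < t -> #|V| = 1 -> det_num (myc_rel t e) = t.
Proof.
move=> sym_e irr_e t_gt0 V1.
have [v Ev] : exists v : V, forall i, i = v.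
  have /card_gt0P[v _] : 0 < #|V| by rewrite V1.
  by exists v => i; have /card_le1_eqP := eq_leq V1; apply.
have e0 i j : e i j = false by rewrite (Ev i) (Ev j) irr_e.
have v0 : isolated e v by apply/forallP => u; rewrite e0.
have card_mu : #|{: myc_vertex t V}| = t.+2.
  by rewrite card_option card_prod card_ord V1 muln1.
apply/eqP; rewrite eqn_leq; apply/andP; split.
  (* Only the bottom vertex and the apex are left out; the former is isolated and the latter is not,
     so they cannot be exchanged. *)
  pose A (s : 'I_t.+1) : {set V} := if s == ord0 then set0 else setT.
  have cardA : #|of_levels A| = t.
    rewrite card_of_levels (bigD1 ord0) //= {1}/A eqxx cards0 add0n.
    rewrite (eq_bigr (fun=> 1)) ?sum_nat_const ?cardC1 ?card_ord ?muln1 //.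
    by move=> s /negbTE s0; rewrite /A s0 cardsT.
  rewrite -[leqRHS]cardA; apply/det_num_le/determiningP => f fA fS.
  have out x : x \notin of_levels A -> (x = Some (ord0, v)) \/ (x = None).
    case: x => [[s i]|]; last by right.
    by rewrite mem_of_levels /A (Ev i); case: eqP => [->|]; [left | rewrite inE].
  have f_out x : f x <> x -> f x \notin of_levels A /\ x \notin of_levels A.
    by move=> neq; split; apply/negP => /fS; [move/perm_inj|].
  apply/permP => x; rewrite perm1; apply/eqP/negPn/negP => /eqP neq.
  have [fxS xS] := f_out x neq.
  have x0 : isolated (myc_rel t e) (Some (ord0, v)) by apply: myc_isolated.
  have nN : ~~ isolated (myc_rel t e) None.
    by apply/negP => /(myc_isolated_inv t_gt0 v) [? [? []]].
  case: (out _ xS) (out _ fxS) neq => -> [] E; rewrite E // => _; apply/negP: nN.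
    by rewrite -E aut_isolated.
  by rewrite -(permK f None) E aut_isolated ?is_autV.
apply: det_num_ge => S dS.
(* The complement of [S] holds at most one isolated vertex and at most one end of the unique edge,
   so [S] has at least [t] of the [t + 2] vertices. *)
pose I := [set x | isolated (myc_rel t e) x].
have leI : #|~: S :&: I| <= 1.
  apply/card_le1_eqP => a b; rewrite !inE => /andP[aS a0] /andP[bS b0].
  exact: (determining_isolated sym_e dS).
have niso x : ~~ isolated (myc_rel t e) x -> x = Some (ord_max, v) \/ x = None.
  case: x => [[s i]|]; last by right.
  rewrite (Ev i) => x_niso; left; have [Es|st] := eqVneq (val s) t.
    by have -> : s = ord_max by apply: val_inj.
  by case/negP: x_niso; apply: myc_isolated => //; have /= := ltn_ord s; move: st => /= ; lia.
have tA : is_aut (myc_rel t e) (tperm (Some (ord_max, v)) None).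
  have muE x y : myc_rel t e x y = (x == Some (ord_max, v)) && (y == None)
                             || (x == None) && (y == Some (ord_max, v)).
    case: x y => [[s i]|] [[s' j]|] //=; rewrite ?e0 ?andbF ?orbF // ?andbT.
      by rewrite (Ev i) (inj_eq Some_inj) xpair_eqE eqxx andbT.
    by rewrite (Ev j) (inj_eq Some_inj) xpair_eqE eqxx andbT.
  apply/is_autP => x y; rewrite !muE.
  have tpE (a b z : myc_vertex t V) : (tperm a b z == a) = (z == b).
    by rewrite -{2}(tpermR a b) (inj_eq perm_inj).
  by rewrite !tpE ![tperm (Some _) _]tpermC !tpE orbC.
have leN : #|~: S :\: I| <= 1.
  apply/card_le1_eqP => a b; rewrite !inE => /andP[a0 aS] /andP[b0 bS].
  have topN : Some (ord_max, v) <> None :> myc_vertex t V by [].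
  have := determining_tperm dS topN tA.
  by case: (niso a a0) (niso b b0) aS bS => -> [] -> //; do 2!move/negbTE->.
have := cardsCs S; have := cardsID I (~: S); rewrite card_mu; lia.
Qed.

Theorem mainTheorem9 (V : finType) (e : rel V) (T : {set V}) (t : nat) :
  simple_graph e ->
  (exists v : V, isolated e v) ->
  min_twin_cover e T ->
  0 < t ->
  (#|V| = 1 -> det_num e = 0 /\ det_num (myc_rel t e) = t) /\
  (#|V| <> 1 -> det_num (myc_rel t e) = t * #|T| + det_num e + t - 1).
Proof.
move=> [sym_e irr_e] [v v_iso] minT t_gt0; split=> [V1|V_neq1].
  by split; [exact: det_num_card1 | exact: det_num_myc_card1].
apply/eqP; rewrite -addnBA // subn1 eqn_leq (det_num_myc_ge sym_e t_gt0 v_iso minT) andbT.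
exact: (det_num_myc_le sym_e t_gt0 V_neq1 v_iso (proj1 minT)).
Qed.
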